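(* Let $\mathbf 1 \in \mathbb{R}^{n\times n}$ be the all ones matrix. There is a sufficiently large constant $c$ such that for any $\epsilon \in (0,1/2)$ with $\epsilon \ge c/\sqrt n$, any matrix $\mathbf S \in \mathbb{R}^{n\times n}$ with $\|\mathbf 1 - \mathbf S\|_2 \le \epsilon n$ must have $\Omega(n/\epsilon^2)$ nonzero entries.
   Context: $\|\cdot\|_2$ denotes the spectral norm. *)

(* Defs.v *)
From HB Require Import structures.
From mathcomp Require Import all_boot all_order all_algebra.
From mathcomp Require Import boolp classical_sets reals.
Set Implicit Arguments.
Unset Strict Implicit.
Unset Printing Implicit Defensive.
Import Order.TTheory GRing.Theory Num.Theory.
Local Open Scope classical_set_scope.
Local Open Scope ring_scope.

Definition l2norm (R : realType) (n : nat) (x : 'cV[R]_n) : R :=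
  Num.sqrt (\sum_(i < n) x i 0 ^+ 2).

(* The operator norm induced by the Euclidean norms. The unit ball is used
   rather than the unit sphere so that the set is nonempty also when n = 0;
   lemma has_sup_spectral_norm shows that [sup] is a genuine supremum here. *)
Definition spectral_norm (R : realType) (m n : nat) (A : 'M[R]_(m, n)) : R :=
  sup [set l2norm (A *m x) | x in [set x : 'cV[R]_n | l2norm x <= 1]].

Definition nnz (R : realType) (m n : nat) (A : 'M[R]_(m, n)) : nat :=
  #|[set p : 'I_m * 'I_n | A p.1 p.2 != 0]%SET|.

Lemma has_sup_spectral_norm (R : realType) (m n : nat) (A : 'M[R]_(m, n)) :
  has_sup [set l2norm (A *m x) | x in [set x : 'cV[R]_n | l2norm x <= 1]].
Proof.
split.
  exists (l2norm (A *m 0)), 0 => //=.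
  rewrite /l2norm big1 ?sqrtr0 // => i _.
  by rewrite mxE expr0n.
exists (Num.sqrt (\sum_(i < m) (\sum_(j < n) `|A i j|) ^+ 2)).
move=> _ [x /= x1 <-]; rewrite /l2norm ler_wsqrtr //; apply: ler_sum => i _.
rewrite -[leLHS]real_normK ?num_real // lerXn2r ?nnegrE ?sumr_ge0 //.
rewrite mxE (le_trans (ler_norm_sum _ _ _)) //; apply: ler_sum => j _.
rewrite normrM ler_piMr // (le_trans _ x1) // -sqrtr_sqr ler_wsqrtr //.
by rewrite (bigD1 j) //= lerDl sumr_ge0 // => k _; rewrite sqr_ge0.
Qed.

(* Main.v *)
(** Let [E := 1 - S] be the error. Applying [E] to the all-ones vector shows
    that the row sums [r_i] of [S] satisfy [sum_i (n - r_i)^2 <= eps^2 n^3],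
    hence [sum_i r_i^2 >= n^3 / 4]. On the other hand every row of [E] has
    Euclidean norm at most [eps n], so every row of [S] has squared norm at most
    [2 eps^2 n^2 + 2 n <= 4 eps^2 n^2]; by Cauchy-Schwarz on its support,
    [r_i^2 <= 4 eps^2 n^2 k_i], where [k_i] is the number of its nonzero
    entries. Summing over [i] gives [nnz S >= n / (16 eps^2)]. *)
Require Import Defs.
From mathcomp Require Import all_boot all_order all_algebra.
From mathcomp Require Import reals.
From mathcomp Require Import ring lra.
Set Implicit Arguments.
Unset Strict Implicit.
Unset Printing Implicit Defensive.
Import Order.TTheory GRing.Theory Num.Theory.
Local Open Scope ring_scope.

Lemma sqr_l2norm (R : realType) (n : nat) (x : 'cV[R]_n) :
  l2norm x ^+ 2 = \sum_(i < n) x i 0 ^+ 2.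
Proof. by rewrite sqr_sqrtr // sumr_ge0 // => i _; rewrite sqr_ge0. Qed.

Lemma l2normZ (R : realType) (n : nat) (a : R) (x : 'cV[R]_n) :
  l2norm (a *: x) = `|a| * l2norm x.
Proof.
rewrite /l2norm -sqrtr_sqr -sqrtrM ?sqr_ge0 // mulr_sumr.
by congr Num.sqrt; apply: eq_bigr => i _; rewrite mxE exprMn.
Qed.

Lemma l2norm_eq0 (R : realType) (n : nat) (x : 'cV[R]_n) :
  l2norm x = 0 -> x = 0.
Proof.
move=> x0; have /eqP := sqr_l2norm x; rewrite x0 expr0n /= eq_sym.
rewrite psumr_eq0 => [/allP x0i|i _]; last exact: sqr_ge0.
apply/colP => i; rewrite mxE; apply/eqP.
by have := x0i i (mem_index_enum _); rewrite sqrf_eq0.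
Qed.

Lemma l2norm_mulmx_le (R : realType) (m n : nat) (A : 'M[R]_(m, n))
    (x : 'cV[R]_n) :
  l2norm (A *m x) <= spectral_norm A * l2norm x.
Proof.
(* The supremum only sees the unit ball, so a nonzero [x] is rescaled to norm 1. *)
have [x0|x_neq0] := eqVneq (l2norm x) 0.
  rewrite x0 mulr0 (l2norm_eq0 x0) mulmx0 -(scale0r 0) l2normZ.
  by rewrite normr0 mul0r.
have x_gt0 : 0 < l2norm x by rewrite lt_def x_neq0 sqrtr_ge0.
rewrite -ler_pdivrMr // mulrC.
apply: (ub_le_sup (has_sup_spectral_norm A).2).
exists ((l2norm x)^-1 *: x); rewrite /= ?l2normZ.
  by rewrite gtr0_norm ?invr_gt0 // mulVf.
by rewrite -scalemxAr l2normZ gtr0_norm ?invr_gt0.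
Qed.

Lemma sum_sqr_mulmx_le (R : realType) (m n : nat) (A : 'M[R]_(m, n))
    (x : 'cV[R]_n) (b : R) :
  spectral_norm A <= b ->
  \sum_i (A *m x) i 0 ^+ 2 <= b ^+ 2 * \sum_j x j 0 ^+ 2.
Proof.
move=> Ab; rewrite -!sqr_l2norm -exprMn.
have Axb : l2norm (A *m x) <= b * l2norm x.
  by rewrite (le_trans (l2norm_mulmx_le _ _)) // ler_wpM2r ?sqrtr_ge0.
have Ax0 : 0 <= l2norm (A *m x) by exact: sqrtr_ge0.
by rewrite lerXn2r ?nnegrE // (le_trans Ax0).
Qed.

Lemma sum_sqr_row_le (R : realType) (m n : nat) (A : 'M[R]_(m, n)) (b : R)
    (i : 'I_m) :
  spectral_norm A <= b -> \sum_j A i j ^+ 2 <= b ^+ 2.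
Proof.
set q := \sum_j A i j ^+ 2 => Ab.
(* Positivity of [q] is needed to cancel it from [q ^+ 2 <= b ^+ 2 * q]. *)
have [|q_gt0] := leP q 0; first by move/le_trans; apply; exact: sqr_ge0.
have xE : \sum_j (row i A)^T j 0 ^+ 2 = q.
  by apply: eq_bigr => j _; rewrite !mxE.
(* The i-th coordinate of A applied to its own i-th row is q. *)
have := sum_sqr_mulmx_le (row i A)^T Ab; rewrite xE => Axq.
rewrite -(ler_pM2r q_gt0) (le_trans _ Axq) // (bigD1 i) //=.
have -> : (A *m (row i A)^T) i 0 = q.
  by rewrite mxE; apply: eq_bigr => j _; rewrite !mxE expr2.
by rewrite expr2 lerDl sumr_ge0 // => k _; rewrite sqr_ge0.
Qed.

(** Cauchy-Schwarz against the indicator of the support, obtained from the nonnegativity of a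
    variance. *)
Lemma sqr_sum_le_card_support (R : realType) (n : nat) (v : 'I_n -> R) :
  (\sum_j v j) ^+ 2 <= #|[set j | v j != 0]|%:R * \sum_j v j ^+ 2.
Proof.
set D := [set j | v j != 0].
have sumD (f : R -> R) : f 0 = 0 -> \sum_j f (v j) = \sum_(j in D) f (v j).
  move=> f0; rewrite [RHS]big_mkcond; apply: eq_bigr => j _; rewrite inE.
  by case: eqP => // ->.
rewrite (sumD id) // (sumD (fun y => y ^+ 2)) ?expr0n //.
set r := \sum_(j in D) v j; set q := \sum_(j in D) _; set k : R := #|D|%:R.
have [D0|D_gt0] := posnP #|D|.
  by rewrite /k D0 mul0r /r (eq_bigl _ _ (card0_eq D0)) big_pred0_eq expr0n.
have k_gt0 : 0 < k by rewrite ltr0n.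
(* Deviations from the mean [r / k], scaled by [k] to avoid division. *)
have : 0 <= \sum_(j in D) (k * v j - r) ^+ 2.
  by apply: sumr_ge0 => j _; rewrite sqr_ge0.
have -> : \sum_(j in D) (k * v j - r) ^+ 2 = k * (k * q - r ^+ 2).
  transitivity (\sum_(j in D) (k ^+ 2 * v j ^+ 2 - 2 * k * r * v j + r ^+ 2)).
    by apply: eq_bigr => j _; ring.
  rewrite big_split sumrB -!mulr_sumr sumr_const -/r -/q -mulr_natr -/k /=.
  by ring.
by rewrite pmulr_rge0 // subr_ge0.
Qed.

Lemma nnz_sum_rows (R : realType) (m n : nat) (A : 'M[R]_(m, n)) :
  nnz A = (\sum_i #|[set j | (A i j != 0)%R]|)%N.
Proof.
rewrite /nnz -sum1_card.
under [RHS]eq_bigr do rewrite -sum1_card.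
by rewrite pair_big_dep; apply: eq_bigl => p; rewrite !inE.
Qed.

Theorem theorem3 (R : realType) :
  exists c : R, 0 < c /\
  exists C : R, 0 < C /\
    forall (n : nat) (eps : R) (S : 'M[R]_n),
      (0 < n)%N ->
      0 < eps -> eps < 1 / 2 ->
      c / Num.sqrt n%:R <= eps ->
      spectral_norm (const_mx 1 - S) <= eps * n%:R ->
      C * (n%:R / eps ^+ 2) <= (nnz S)%:R.
Proof.
(* [c = 1] yields [1 <= eps ^+ 2 * N]; [1 / 16] is the 1/4 of [r_ge] divided by the 4 of
   [row_le]. *)
exists 1; split=> //; exists (1 / 16); split; first by rewrite divr_gt0.
move=> n eps S n_gt0 eps_gt0 eps_lt eps_ge SN.
set N : R := n%:R; have N_gt0 : 0 < N by rewrite ltr0n.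
have eps2N : 1 <= eps ^+ 2 * N.
  rewrite -[X in _ * X](sqr_sqrtr (ltW N_gt0)) -exprMn.
  by rewrite exprn_ege1 // -ler_pdivrMr ?sqrtr_gt0.
pose r i := \sum_j S i j; pose k i : R := #|[set j | S i j != 0]|%:R.
have row_le i : r i ^+ 2 <= k i * (4 * eps ^+ 2 * N ^+ 2).
  apply: le_trans (sqr_sum_le_card_support _) _.
  rewrite ler_wpM2l ?ler0n //.
  have Ei := sum_sqr_row_le i SN.
  have : \sum_j S i j ^+ 2 <=
         \sum_j (2 * (const_mx 1 - S) i j ^+ 2 + 2).
    apply: ler_sum => j _; rewrite !mxE.
    (* With [s = S i j], the difference of the two sides is exactly [(s - 2) ^+ 2]. *)
    by have := sqr_ge0 (S i j - 2); nra.
  rewrite big_split -mulr_sumr sumr_const card_ord -mulr_natr -/N /=.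
  rewrite exprMn -/N in Ei.
  (* Here [N <= eps ^+ 2 * N ^+ 2] absorbs the extra [2 * N]. *)
  by have := ler_wpM2r (ltW N_gt0) eps2N; lra.
have E1 : \sum_i (N - r i) ^+ 2 <= eps ^+ 2 * N ^+ 3.
  have := sum_sqr_mulmx_le (const_mx 1) SN.
  under eq_bigr => i _.
    rewrite mxE.
    under eq_bigr do rewrite !mxE mulr1.
    rewrite sumrB sumr_const card_ord -/N -/(r i); over.
  under [in leRHS]eq_bigr do rewrite mxE expr1n.
  by rewrite sumr_const card_ord exprMn -/N -mulrA -exprSr.
have r_ge : N ^+ 3 / 4 <= \sum_i r i ^+ 2.
  have : \sum_(i < n) N ^+ 2 <= \sum_i (2 * (N - r i) ^+ 2 + 2 * r i ^+ 2).
    apply: ler_sum => i _.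
    (* Again the difference of the two sides is this square. *)
    by have := sqr_ge0 (N - 2 * r i); nra.
  rewrite sumr_const card_ord -(mulr_natr (N ^+ 2)) -/N -exprSr.
  rewrite big_split -!mulr_sumr /=.
  (* By [E1] the error part is then at most [N ^+ 3 / 2], leaving half of [N ^+ 3] for
     [2 * \sum_i r i ^+ 2]. *)
  have eps2 : eps ^+ 2 <= 1 / 4 by nra.
  have := ler_wpM2r (exprn_ge0 3 (ltW N_gt0)) eps2.
  by lra.
have : \sum_i r i ^+ 2 <= (nnz S)%:R * (4 * eps ^+ 2 * N ^+ 2).
  rewrite nnz_sum_rows natr_sum mulr_suml; apply: ler_sum => i _.
  exact: row_le.
move/(le_trans r_ge) => le.
rewrite mulrA ler_pdivrMr ?exprn_gt0 // -(ler_pM2r (exprn_gt0 2 N_gt0)).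
rewrite exprS in le.
by lra.
Qed.
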